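(* Let $\mathcal A\subseteq 2^X$ be a hypergraph on a finite set $X$ (an empty hyperedge is allowed). The map $T\mapsto B_{\mathcal A}\cup T$ is an inclusion-order isomorphism from the family of all transversals of $\mathcal A$ onto $\operatorname{Stop}(\mathcal H_{\mathcal A})\setminus\{\varnothing\}$. Consequently, $$\operatorname{MinStop}(\mathcal H_{\mathcal A})=\{B_{\mathcal A}\cup T: T\in\operatorname{Tr}(\mathcal A)\}.$$ Under complementation, the map $T\mapsto U_{\mathcal A}\setminus(B_{\mathcal A}\cup T)=X\setminus T$ is a bijection from $\operatorname{Tr}(\mathcal A)$ onto the family of coatoms of $\operatorname{Mod}(\Phi_{\mathcal H_{\mathcal A}})$. The hypergraph $\mathcal H_{\mathcal A}$ has incidence length $O(L(\mathcal A))$ and can be constructed in $O(L(\mathcal A))$ time. For bit-vector outputs, the forward map and the inverse map are computable in $O(L(\mathcal A))$ time per output.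
   Context: For a hypergraph $\mathcal A\subseteq 2^X$ on a finite set $X$ (no duplicate hyperedges, but the empty hyperedge retained if present), $L(\mathcal A)=|X|+|\mathcal A|+\sum_{E\in\mathcal A}|E|$ is its incidence length. A set $T\subseteq X$ is a transversal of $\mathcal A$ if $T\cap E\ne\varnothing$ for every $E\in\mathcal A$; $\operatorname{Tr}(\mathcal A)$ is the family of inclusion-minimal transversals. Construction of $\mathcal H_{\mathcal A}$: introduce a new element $r$ and, for every $x\in X$, a new element $\bar x$. The ground set is $U_{\mathcal A}=X\cup\{r\}\cup\{\bar x:x\in X\}$. The hyperedges are $\{r,\bar x\}$ and $\{r,x,\bar x\}$ for every $x\in X$, and $\{r\}\cup E$ for every $E\in\mathcal A$. Put $B_{\mathcal A}=\{r\}\cup\{\bar x:x\in X\}$. For a hypergraph $\mathcal H$ on $V$: a stopping set is a set $S\subseteq V$ with $|A\cap S|\neq1$ for every $A\in\mathcal H$; $\operatorname{Stop}(\mathcal H)$ is the family of stopping sets and $\operatorname{MinStop}(\mathcal H)$ the family of inclusion-minimal nonempty stopping sets. $\Phi_{\mathcal H}=\bigwedge_{A\in\mathcal H}\bigwedge_{v\in A}((A\setminus\{v\})\to v)$ is the associated definite Horn CNF, with model family $\operatorname{Mod}(\Phi_{\mathcal H})\subseteq 2^V$ (models identified with sets of true variables), and a coatom is an inclusion-maximal member of $\operatorname{Mod}(\Phi_{\mathcal H})\setminus\{V\}$. The incidence length of $\mathcal H$ is $|V|+|\mathcal H|+\sum_{A\in\mathcal H}|A|$. *)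

(* Defs.v *)
From mathcomp Require Import all_boot.

Set Implicit Arguments.
Unset Strict Implicit.
Unset Printing Implicit Defensive.

(* A hypergraph on V is a set of subsets of V: no repeated hyperedges, and
   set0 may be a hyperedge. The ground set is the whole finite type. *)
Notation hypergraph V := {set {set V}}.

Section Hypergraphs.
Variable V : finType.
Implicit Types (H : hypergraph V) (S T M : {set V}).

Definition inc_length H : nat := #|V| + #|H| + \sum_(E in H) #|E|.

Definition is_transversal H T : bool := [forall E in H, T :&: E != set0].
Definition transversals H : {set {set V}} := [set T | is_transversal H T].
Definition Tr H : {set {set V}} := [set T | minset (is_transversal H) T].

Definition Stop H : {set {set V}} := [set S | [forall E in H, #|E :&: S| != 1]].
Definition MinStop H : {set {set V}} :=
  [set S | minset [pred S' | (S' \in Stop H) && (S' != set0)] S].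

(* The definite Horn clause P -> v is the pair (P, v). *)
Definition horn_clause := ({set V} * V)%type.
Definition horn_cnf := {set horn_clause}.

Definition sat_clause M (C : horn_clause) : bool := (C.1 \subset M) ==> (C.2 \in M).
Definition Mod (Phi : horn_cnf) : {set {set V}} :=
  [set M | [forall C in Phi, sat_clause M C]].
Definition coatoms (F : {set {set V}}) : {set {set V}} :=
  [set M | maxset [pred M' | (M' \in F) && (M' != setT)] M].

Definition Phi H : horn_cnf := [set (E :\ v, v) | E in H, v in E].

End Hypergraphs.

Section Maps.
Variables V W : finType.
Implicit Types (f : {set V} -> {set W}) (F : {set {set V}}) (G : {set {set W}}).

Definition bij_onto f F G : Prop := {in F &, injective f} /\ f @: F = G.
Definition order_iso_onto f F G : Prop :=
  bij_onto f F G /\ {in F &, forall S T, (f S \subset f T) = (S \subset T)}.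

End Maps.

Section Construction.
Variable X : finType.

(* The disjoint union of X, {r} and {bar x : x in X}. *)
Definition U : finType := (X + unit + X)%type.
Definition old (x : X) : U := inl (inl x).
Definition r : U := inl (inr tt).
Definition bar (x : X) : U := inr x.

(* A subset of X, seen as a subset of U. *)
Definition emb (T : {set X}) : {set U} := old @: T.

Definition HA (A : hypergraph X) : hypergraph U :=
  [set [set r; bar x] | x : X] :|: [set [set r; old x; bar x] | x : X]
  :|: [set r |: emb E | E in A].

Definition B : {set U} := r |: [set bar x | x : X].

Definition toStop (T : {set X}) : {set U} := B :|: emb T.
Definition toMod (T : {set X}) : {set U} := ~: toStop T.

End Construction.

(* Random access machine: a memory of natural numbers, all 0 initially, with
   direct and indirect addressing, a one-way read-only input tape and a one-way
   write-only output tape. Every instruction and every test costs one time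
   unit. [exec w] is the machine whose words hold the numbers 0, ..., w: a run
   that would put a larger number in memory is stuck. *)
Inductive cmd : Type :=
| Skip
| Const of nat & nat       (* M[i] := k           *)
| Add of nat & nat & nat   (* M[i] := M[j] + M[k] *)
| Sub of nat & nat & nat   (* M[i] := M[j] - M[k], truncated at 0 *)
| Fetch of nat & nat        (* M[i] := M[M[j]]     *)
| Store of nat & nat       (* M[M[i]] := M[j]     *)
| Read of nat              (* M[i] := next input word *)
| Write of nat             (* append M[i] to the output *)
| Seq of cmd & cmd
| If of nat & cmd & cmd    (* tests M[i] <> 0 *)
| While of nat & cmd.      (* tests M[i] <> 0 *)

Record state : Type := State { mem : nat -> nat; inp : seq nat; out : seq nat }.

Definition init (u : seq nat) : state := State (fun=> 0) u [::].
Definition set_mem (s : state) (i v : nat) : state :=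
  State [eta mem s with i |-> v] (inp s) (out s).

Inductive exec (w : nat) : cmd -> state -> nat -> state -> Prop :=
| exec_Skip s : exec w Skip s 1 s
| exec_Const s i k : k <= w -> exec w (Const i k) s 1 (set_mem s i k)
| exec_Add s i j k : mem s j + mem s k <= w ->
    exec w (Add i j k) s 1 (set_mem s i (mem s j + mem s k))
| exec_Sub s i j k :
    exec w (Sub i j k) s 1 (set_mem s i (mem s j - mem s k))
| exec_Fetch s i j : exec w (Fetch i j) s 1 (set_mem s i (mem s (mem s j)))
| exec_Store s i j : exec w (Store i j) s 1 (set_mem s (mem s i) (mem s j))
| exec_Read s i v u : inp s = v :: u -> v <= w ->
    exec w (Read i) s 1 (State [eta mem s with i |-> v] u (out s))
| exec_Write s i :
    exec w (Write i) s 1 (State (mem s) (inp s) (rcons (out s) (mem s i)))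
| exec_Seq p q s1 t1 s2 t2 s3 : exec w p s1 t1 s2 -> exec w q s2 t2 s3 ->
    exec w (Seq p q) s1 (t1 + t2) s3
| exec_IfT i p q s1 t s2 : mem s1 i != 0 -> exec w p s1 t s2 ->
    exec w (If i p q) s1 t.+1 s2
| exec_IfF i p q s1 t s2 : mem s1 i = 0 -> exec w q s1 t s2 ->
    exec w (If i p q) s1 t.+1 s2
| exec_WhileT i p s1 t1 s2 t2 s3 : mem s1 i != 0 -> exec w p s1 t1 s2 ->
    exec w (While i p) s2 t2 s3 -> exec w (While i p) s1 (t1 + t2).+1 s3
| exec_WhileF i p s : mem s i = 0 -> exec w (While i p) s 1 s.

(* p maps the input u to the output v in time at most b. All numbers stored
   are at most b too: for b = O(L), words have log L + O(1) bits, so that unit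
   costs are not abused by computing with huge numbers. *)
Definition runs_within (p : cmd) (b : nat) (u v : seq nat) : Prop :=
  exists t s, [/\ t <= b, exec b p (init u) t s & out s = v].

(* The value 1 at L = 0 only matters when X and A are both empty, where HA A
   still has incidence length 1. *)
Definition bigO (c L : nat) : nat := c * maxn 1 L.

Section Encodings.
Variable V : finType.

Definition to_set (e : seq V) : {set V} := [set x in e].

(* Elements of V are numbered from 0 by enum_rank; for V = U X, this numbers
   X first, as in X alone, then r, then the bar x in the order of X. *)
Definition encode_edge (e : seq V) : seq nat :=
  size e :: [seq val (enum_rank x) | x <- e].

(* The hyperedges, and the elements of each of them, are listed in any order,
   without repetition. *)
Definition encodes (H : hypergraph V) (u : seq nat) : Prop :=
  exists es : seq (seq V),
    [/\ all uniq es, uniq [seq to_set e | e <- es],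
        H =i [seq to_set e | e <- es]
      & u = #|V| :: size es :: flatten [seq encode_edge e | e <- es]].

Definition bits (S : {set V}) : seq nat := [seq nat_of_bool (x \in S) | x <- enum V].

End Encodings.

(* Main.v *)
Require Import Defs.
From mathcomp Require Import all_boot zify.
Import Defs.

Set Implicit Arguments.
Unset Strict Implicit.
Unset Printing Implicit Defensive.

(** Why the theorem holds.

    Combinatorics.  If a stopping set S of [HA A] contains r, the edge {r, bar x}
    forces every bar x into S; if S contains bar x, the same edge forces r; and if S
    contains x, the edge {r, x, bar x} forces r or bar x.  So a nonempty S contains
    [B X], that is, S = [toStop T] with T the trace of S on X.  Two elements of S then
    lie in every edge {r, bar x} and {r, x, bar x}, and the edge {r} + E meets S in r
    alone exactly when T misses E.  Hence [toStop T] is a stopping set exactly when T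
    is a transversal ([toStop_iso]; an empty hyperedge of A excludes both).  An order
    isomorphism carries minimal members to minimal members ([minset_order_iso]), which
    gives [MinStop_HA].  A set M violates a clause E - v -> v exactly when v is the
    only element of E outside M, so the models are the complements of the stopping
    sets ([Mod_PhiC]) and the coatoms are the complements of the minimal nonempty ones.

    Running times.  In the numbering of [U X], X comes first, then r has number n, then
    bar x has number n + 1 plus that of x.  So one pass over the input suffices: the
    edges on r, x, bar x are written by counting ([vertex_body]), and an edge E is
    copied with its size increased and n prepended ([edge_body]); the lemma is
    [construct_run].  On bit vectors, [toStop] appends n + 1 ones, and [toMod]
    flips the n bits and appends n + 1 zeros; both inverses read the first n bits only
    ([forward_run], [backward_run]).  The programs are verified with triples that
    carry a time budget ([completes]); every loop is indexed by the list it still has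
    to process, and its cost is a sum over that list ([completes_While]). *)

(** * Stopping sets and Horn models *)

Section Horn.
Variable V : finType.
Implicit Types (H : hypergraph V) (M S : {set V}).

(** The clause E - v -> v fails at M exactly when v is the only element of E in the
    complement of M. *)
Lemma Mod_PhiC H M : (M \in Mod (Phi H)) = (~: M \in Stop H).
Proof.
rewrite !inE; apply/forall_inP/forall_inP => [modM E EH | stopM C].
  apply/negP => /cards1P [v EMv].
  have /setIP [vE] : v \in E :&: ~: M by rewrite EMv set11.
  rewrite inE => /negP; apply; move: (modM (E :\ v, v)).
  rewrite /sat_clause /= => /(_ (imset2_f _ EH vE)) /implyP; apply.
  apply/subsetP => x /setD1P [xv xE]; apply: contraNT xv => xM.
  by rewrite -in_set1 -EMv !inE xE.
case/imset2P => E v EH vE ->; rewrite /sat_clause /=; apply/implyP => EvM.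
have := stopM E EH; apply: contraNT => vM; apply/cards1P; exists v.
apply/setP => x; rewrite !inE; case: eqVneq => [-> | xv]; first by rewrite vE vM.
by apply/negbTE/negP => /andP [xE] /negP; apply; rewrite (subsetP EvM) // !inE xv.
Qed.

Lemma coatoms_MinStop H : coatoms (Mod (Phi H)) = [set ~: S | S in MinStop H].
Proof.
have coatomC M : (M \in coatoms (Mod (Phi H))) = (~: M \in MinStop H).
  rewrite !inE maxminset; apply: minset_eq => S.
  rewrite /= Mod_PhiC setCK; congr (_ && ~~ _).
  by apply/eqP/eqP => [eqT | ->]; rewrite ?setC0 // -(setCK S) eqT setCT.
apply/setP => M; rewrite coatomC; apply/idP/imsetP => [MC | [S SH ->]].
  by exists (~: M); rewrite ?setCK.
by rewrite setCK.
Qed.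

End Horn.

(** * Stopping sets of the constructed hypergraph *)

Lemma minset_order_iso (V W : finType) (f : {set V} -> {set W}) F G :
  order_iso_onto f F G ->
  [set S | minset [in G] S] = f @: [set T | minset [in F] T].
Proof.
case=> -[_ <-] leF; apply/setP => S; rewrite inE.
apply/minsetP/imsetP => [[/imsetP [T TF ->] minT] | [T]].
  exists T => //; rewrite inE; apply/minsetP; split=> // T' T'F T'T.
  have eqf : f T' = f T by apply: minT; [apply: (imset_f f T'F) | rewrite leF].
  by apply/eqP; rewrite eqEsubset T'T -leF // eqf subxx.
rewrite inE => /minsetP [TF minT] ->; split; first exact: imset_f.
by move=> _ /imsetP [T' T'F ->]; rewrite leF // => /(minT _ T'F) ->.
Qed.

(** The form in which the stopping condition is used: an edge that meets a stopping set
    forces a second element into it. *)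
Lemma Stop_second (V : finType) (H : hypergraph V) S E v :
  S \in Stop H -> E \in H -> v \in E -> v \in S ->
  exists u, [/\ u \in E, u \in S & u != v].
Proof.
rewrite inE => /forall_inP stS EH vE vS.
have /set0Pn [u] : (E :&: S) :\ v != set0.
  have := stS E EH; rewrite (cardsD1 v) inE vE vS -cards_eq0.
  by case: #|_|.
by rewrite !inE => /and3P [uv uE uS]; exists u.
Qed.

Lemma card_neq1 (V : finType) (S : {set V}) x y :
  x \in S -> y \in S -> x != y -> #|S| != 1.
Proof.
move=> xS yS; apply: contraNneq => /eqP/cards1P [z Sz].
by move: xS yS; rewrite Sz !inE => /eqP-> /eqP->.
Qed.

Section Structure.
Variable X : finType.
Implicit Types (A : hypergraph X) (T : {set X}) (S : {set U X}).

Lemma old_inj : injective (@old X). Proof. by move=> x y []. Qed.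

Lemma old_emb T x : (old x \in emb T) = (x \in T).
Proof. exact: mem_imset old_inj. Qed.

Lemma r_emb T : (r X \in emb T) = false.
Proof. by apply/negP => /imsetP []. Qed.

Lemma bar_emb T x : (bar x \in emb T) = false.
Proof. by apply/negP => /imsetP []. Qed.

Lemma old_toStop T x : (old x \in toStop T) = (x \in T).
Proof. by rewrite !inE old_emb /=; case: imsetP => // -[]. Qed.

Lemma r_toStop T : r X \in toStop T.
Proof. by rewrite !inE eqxx. Qed.

Lemma bar_toStop T x : bar x \in toStop T.
Proof. by rewrite !inE imset_f ?orbT. Qed.

Lemma toStop_sub T1 T2 : (toStop T1 \subset toStop T2) = (T1 \subset T2).
Proof.
apply/subsetP/subsetP => [sT x xT | sT].
  by rewrite -old_toStop sT // old_toStop.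
case=> [[x | []] | x]; last by rewrite !bar_toStop.
  by rewrite !old_toStop; apply: sT.
by rewrite !r_toStop.
Qed.

Lemma toStop_inj : injective (@toStop X).
Proof. by move=> T1 T2 eqT; apply/eqP; rewrite eqEsubset -!toStop_sub eqT subxx. Qed.

Lemma toModE T : toMod T = emb (~: T).
Proof.
apply/setP=> -[[x | []] | x]; rewrite in_setC.
- by rewrite old_toStop old_emb inE.
- by rewrite r_toStop r_emb.
by rewrite bar_toStop bar_emb.
Qed.

Lemma HA_pair A x : [set r X; bar x] \in HA A.
Proof. by rewrite !in_setU; do 2!(apply/orP; left); apply/imsetP; exists x. Qed.

Lemma HA_triple A x : [set r X; old x; bar x] \in HA A.
Proof. by rewrite !in_setU; apply/orP; left; apply/orP; right; apply/imsetP; exists x. Qed.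

Lemma HA_edge A E : E \in A -> r X |: emb E \in HA A.
Proof. by move=> EA; rewrite in_setU; apply/orP; right; apply/imsetP; exists E. Qed.

Lemma toStop_Stop A T : T \in transversals A -> toStop T \in Stop (HA A).
Proof.
rewrite !inE => /forall_inP trT; apply/forall_inP => F.
have rx x : r X != bar x by [].
rewrite !inE -orbA => /or3P [/imsetP [x _ ->] | /imsetP [x _ ->] | /imsetP [E EA ->]].
- by apply: card_neq1 (rx x); rewrite in_setI ?r_toStop ?bar_toStop !inE eqxx ?orbT.
- by apply: card_neq1 (rx x); rewrite in_setI ?r_toStop ?bar_toStop !inE eqxx ?orbT.
have /set0Pn [x /setIP [xT xE]] := trT E EA.
apply: (@card_neq1 _ _ (r X) (old x)) => //; rewrite in_setI ?r_toStop ?old_toStop.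
  by rewrite !inE eqxx.
by rewrite !inE old_emb xE xT.
Qed.

(** Both directions come from the two-element edge on r and bar x. *)
Lemma Stop_bar A S x : S \in Stop (HA A) -> (bar x \in S) = (r X \in S).
Proof.
move=> stS; apply/idP/idP => [xS | rS].
  have [u [+ uS /negP nu]] := Stop_second stS (HA_pair A x) (setU1r _ (set11 _)) xS.
  by rewrite !inE => /orP [/eqP <- | /nu].
have [u [+ uS /negP nu]] := Stop_second stS (HA_pair A x) (setU11 _ _) rS.
by rewrite !inE => /orP [/nu | /eqP <-].
Qed.

(** An element x of X in S brings r directly, or bar x and then r. *)
Lemma Stop_r A S : S \in Stop (HA A) -> S != set0 -> r X \in S.
Proof.
move=> stS /set0Pn [[[x | []] | x] xS] //; last by rewrite -(Stop_bar x stS).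
have x_triple : old x \in [set r X; old x; bar x] by rewrite !inE eqxx orbT.
have [u [+ uS /negP nu]] := Stop_second stS (HA_triple A x) x_triple xS.
rewrite !inE -orbA => /or3P [/eqP <- // | /nu // | /eqP u_bar].
by rewrite -(Stop_bar x stS) -u_bar.
Qed.

(** Once r is in S, all of [B X] is, and the edge {r} + E needs a second element in S,
    which can only come from E. *)
Lemma Stop_toStop A S : S \in Stop (HA A) -> S != set0 ->
  exists2 T, T \in transversals A & S = toStop T.
Proof.
move=> stS S0; have rS := Stop_r stS S0.
exists [set x | old x \in S].
  rewrite inE; apply/forall_inP => E EA; apply/set0Pn.
  have [u [+ uS /negP nu]] := Stop_second stS (HA_edge EA) (setU11 _ _) rS.
  case/setU1P => [/eqP /nu // | /imsetP [x xE ux]].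
  by exists x; rewrite !inE xE -ux uS.
apply/setP => -[[x | []] | x].
- by rewrite old_toStop inE.
- by rewrite rS r_toStop.
by rewrite bar_toStop (Stop_bar x stS).
Qed.

Lemma toStop_iso A :
  order_iso_onto (@toStop X) (transversals A) (Stop (HA A) :\ set0).
Proof.
split; last by move=> T1 T2 _ _; apply: toStop_sub.
split; first by move=> T1 T2 _ _; apply: toStop_inj.
apply/setP => S; apply/imsetP/setD1P => [[T + ->] | [S0 stS]].
  move=> trT; split; last exact: toStop_Stop.
  by apply/set0Pn; exists (r X); apply: r_toStop.
by have [T trT ->] := Stop_toStop stS S0; exists T.
Qed.

Lemma MinStop_HA A : MinStop (HA A) = [set toStop T | T in Tr A].
Proof.
have -> : Tr A = [set T | minset [in transversals A] T].
  by apply/setP => T; rewrite !inE; apply: minset_eq => T'; rewrite /= inE.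
rewrite -(minset_order_iso (toStop_iso A)).
by apply/setP => S; rewrite !inE; apply: minset_eq => S'; rewrite /= in_setD1 andbC.
Qed.

Lemma toMod_bij A : bij_onto (@toMod X) (Tr A) (coatoms (Mod (Phi (HA A)))).
Proof.
split; first by move=> T1 T2 _ _ /(can_inj (@setCK _)) /toStop_inj.
by rewrite coatoms_MinStop MinStop_HA -imset_comp.
Qed.

End Structure.

(** * Listings and their numerical encodings *)

Section Listing.
Variable V : finType.
Implicit Types (H : hypergraph V) (e : seq V) (es : seq (seq V)).

(** The condition on a list of edges in [encodes], separated from its number string. *)
Definition listing H es : Prop :=
  [/\ all uniq es, uniq [seq to_set e | e <- es] & H =i [seq to_set e | e <- es]].

Lemma listing_enum H : listing H [seq enum E | E : {set V} in H].
Proof.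
have listE : [seq to_set e | e <- [seq enum E | E : {set V} in H]] = enum H.
  rewrite -map_comp -[RHS]map_id; apply: eq_map => E /=.
  by apply/setP => x; rewrite inE mem_enum.
split; first by apply/allP => _ /mapP [E _ ->]; apply: enum_uniq.
  by rewrite listE enum_uniq.
by move=> E; rewrite listE mem_enum.
Qed.

Lemma inc_length_listing H es : listing H es ->
  inc_length H = #|V| + size es + \sum_(e <- es) size e.
Proof.
case=> uniq_es uniq_s defH; have cardH : #|H| = size es.
  by rewrite (eq_card defH) (card_uniqP uniq_s) size_map.
rewrite /inc_length cardH; congr (_ + _).
rewrite (eq_bigl _ _ defH) -big_uniq //= big_map big_seq [RHS]big_seq.
apply: eq_bigr => e e_es.
have /card_uniqP <- : uniq e by apply: (allP uniq_es).
by apply: eq_card => x; rewrite inE.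
Qed.

Lemma val_enum_rank (x : V) : val (enum_rank x) = index x (enum V).
Proof.
by rewrite -[in RHS](nth_enum_rank x x) index_uniq ?enum_uniq // -cardE.
Qed.

Lemma enum_rank_iota : [seq val (enum_rank x) | x <- enum V] = iota 0 #|V|.
Proof.
have s_enum : size [seq val (enum_rank x) | x <- enum V] = #|V|.
  by rewrite size_map -cardE.
apply: (@eq_from_nth _ 0) => [|i]; rewrite s_enum ?size_iota // => i_lt.
have x0 : V by apply: (enum_val (Ordinal i_lt)).
rewrite nth_iota // (nth_map x0) -?cardE //.
by rewrite val_enum_rank index_uniq ?enum_uniq -?cardE.
Qed.

End Listing.

Lemma enum_sum (S T : finType) :
  enum {: S + T} = [seq inl x | x <- enum S] ++ [seq inr y | y <- enum T].
Proof. by rewrite !enumT [in LHS]unlock. Qed.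

Lemma sum_const_nat_seq (T : Type) (l : seq T) c : \sum_(a <- l) c = size l * c.
Proof. by rewrite big_const_seq count_predT iter_addn_0 mulnC. Qed.

Section Coding.
Variable X : finType.
Implicit Types (A : hypergraph X) (T : {set X}) (es : seq (seq X)).

Lemma enum_U : enum (U X) = [seq old x | x <- enum X] ++ r X :: [seq bar x | x <- enum X].
Proof.
have enum_unit : enum {: unit} = [:: tt] by rewrite enumT unlock.
by rewrite enum_sum enum_sum map_cat enum_unit -!map_comp -catA.
Qed.

Lemma card_U : #|U X| = #|X| + #|X|.+1.
Proof. by rewrite !card_sum card_unit addn1 addSnnS. Qed.

Lemma rank_old (x : X) : val (enum_rank (old x)) = val (enum_rank x).
Proof.
rewrite !val_enum_rank enum_U index_cat mem_map ?mem_enum /=; last exact: old_inj.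
by rewrite index_map //; exact: old_inj.
Qed.

Lemma rank_r : val (enum_rank (r X)) = #|X|.
Proof.
rewrite val_enum_rank enum_U index_cat /= addn0 size_map -cardE.
by case: mapP => // -[].
Qed.

Lemma rank_bar (x : X) : val (enum_rank (bar x)) = #|X|.+1 + val (enum_rank x).
Proof.
rewrite !val_enum_rank enum_U index_cat /= size_map -cardE.
case: mapP => [[] // | _]; rewrite index_map ?addnS ?addSn //.
by move=> ? ? [].
Qed.

(** The pair and the triple of each vertex are adjacent, as they are output by a single
    loop over the vertices. *)
Definition HA_list es : seq (seq (U X)) :=
  flatten [seq [:: [:: r X; bar x]; [:: r X; old x; bar x]] | x <- enum X]
  ++ [seq r X :: [seq old x | x <- e] | e <- es].

(** Regrouping the edges by kind: each kind is the image of a duplicate-free list under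
    an injective map, and the kinds are told apart by their elements of X and bar X. *)
Lemma HA_list_perm es :
  perm_eq [seq to_set F | F <- HA_list es]
    ([seq [set r X; bar x] | x <- enum X] ++ [seq [set r X; old x; bar x] | x <- enum X]
     ++ [seq r X |: emb E | E <- [seq to_set e | e <- es]]).
Proof.
rewrite map_cat catA perm_cat //.
  elim: (enum X) => //= x l IHl.
  have -> : to_set [:: r X; bar x] = [set r X; bar x].
    by apply/setP => u; rewrite !inE.
  have -> : to_set [:: r X; old x; bar x] = [set r X; old x; bar x].
    by apply/setP => u; rewrite !inE -orbA.
  by rewrite perm_cons perm_sym (perm_catCA _ [:: _]) perm_cons perm_sym.
rewrite -!map_comp; apply/permP => a; congr count.
apply: eq_map => e /=; apply/setP => u; rewrite !inE; congr (_ || _).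
by apply/mapP/imsetP => [] [x xe ->]; exists x; rewrite ?inE in xe *.
Qed.

Lemma listing_HA A es : listing A es -> listing (HA A) (HA_list es).
Proof.
case=> uniq_es uniq_s defA; have permL := HA_list_perm es.
split=> [|| F]; last 1 first.
- rewrite (perm_mem permL) !mem_cat !in_setU -orbA; congr [|| _, _ | _].
  + by apply/imsetP/mapP => -[x _ ->]; exists x; rewrite ?mem_enum.
  + by apply/imsetP/mapP => -[x _ ->]; exists x; rewrite ?mem_enum.
  by apply/imsetP/mapP => -[E EA ->]; exists E; rewrite ?defA // -defA.
- rewrite all_cat; apply/andP; split.
    by apply/allP => F /flatten_mapP [x _]; rewrite !inE => /orP [] /eqP ->.
  apply/allP => _ /mapP [e /(allP uniq_es) uniq_e ->] /=.
  rewrite map_inj_uniq ?uniq_e ?andbT; last exact: old_inj.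
  by apply/mapP => -[].
have pair_inj : injective (fun x : X => [set r X; bar x]).
  by move=> x y /setP /(_ (bar x)); rewrite !inE eqxx /= => /esym/eqP [].
have triple_inj : injective (fun x : X => [set r X; old x; bar x]).
  by move=> x y /setP /(_ (bar x)); rewrite !inE eqxx /= => /esym/eqP [].
have edge_inj : injective (fun E : {set X} => r X |: emb E).
  move=> E1 E2 /setP eqE; apply/setP => x; move/(_ (old x)): eqE.
  by rewrite !inE !old_emb.
rewrite (perm_uniq permL) !cat_uniq (map_inj_uniq pair_inj) (map_inj_uniq triple_inj).
rewrite (map_inj_uniq edge_inj) enum_uniq uniq_s andbT has_cat negb_or /=.
(* Triples contain an x, pairs do not; lifted edges contain no bar y. *)
rewrite -andbA; apply/and3P; split; apply/hasPn => _ /mapP [z _ ->]; apply/mapP => -[y _].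
- by move=> /setP /(_ (old z)); rewrite !inE eqxx.
- by move=> /setP /(_ (bar y)); rewrite !inE bar_emb eqxx.
by move=> /setP /(_ (bar y)); rewrite !inE bar_emb eqxx orbT.
Qed.

Lemma size_HA_list es : size (HA_list es) = #|X| + #|X| + size es.
Proof.
rewrite size_cat size_map; congr (_ + _).
by rewrite cardE; elim: (enum X) => //= x l ->; rewrite addnS.
Qed.

Lemma sum_HA_list es :
  \sum_(e <- HA_list es) size e = 5 * #|X| + \sum_(e <- es) (size e).+1.
Proof.
rewrite big_cat big_map /=; congr (_ + _).
  rewrite big_flatten big_map cardE; under eq_bigr do rewrite !big_cons big_nil /=.
  by rewrite sum_const_nat_seq mulnC.
by apply: eq_bigr => e _; rewrite /= size_map.
Qed.

Lemma inc_length_HA A : inc_length (HA A) <= 9 * inc_length A + 1.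
Proof.
have listA := listing_enum A.
rewrite (inc_length_listing (listing_HA listA)) (inc_length_listing listA).
rewrite card_U size_HA_list sum_HA_list.
by under eq_bigr do rewrite -addn1; rewrite big_split /= sum1_size; lia.
Qed.

(** The code of the pair and the triple of the vertex number i, among n vertices. *)
Definition encode_vertex n i := [:: 2; n; n.+1 + i; 3; n; i; n.+1 + i].

(** The code of the edge {r} + E, where s lists the numbers of the elements of E. *)
Definition encode_lifted n (s : seq nat) := (size s).+1 :: n :: s.

Lemma encode_HA_list es :
  flatten [seq encode_edge e | e <- HA_list es] =
  flatten [seq encode_vertex #|X| i | i <- iota 0 #|X|]
  ++ flatten [seq encode_lifted #|X| s
             | s <- [seq [seq val (enum_rank x) | x <- e] | e <- es]].
Proof.
rewrite map_cat flatten_cat -enum_rank_iota; congr (_ ++ _).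
  elim: (enum X) => //= x l ->.
  by rewrite /encode_edge /= rank_r rank_bar rank_old.
congr flatten; rewrite -2!map_comp; apply: eq_map => e /=.
rewrite /encode_edge /encode_lifted /= rank_r !size_map -map_comp.
by congr [:: _, _ & _]; apply: eq_map => x /=; rewrite rank_old.
Qed.

Lemma bits_blocks (S : {set U X}) :
  bits S = [seq nat_of_bool (old x \in S) | x <- enum X] ++
           nat_of_bool (r X \in S) :: [seq nat_of_bool (bar x \in S) | x <- enum X].
Proof. by rewrite /bits enum_U map_cat /= -2!map_comp. Qed.

Lemma bits_toStop T : bits (toStop T) = bits T ++ nseq #|X|.+1 1.
Proof.
rewrite bits_blocks r_toStop cardE; congr (_ ++ _ :: _).
  by apply: eq_map => x; rewrite old_toStop.
by elim: (enum X) => //= x l ->; rewrite bar_toStop.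
Qed.

Lemma bits_toMod T : bits (toMod T) = bits (~: T) ++ nseq #|X|.+1 0.
Proof.
rewrite bits_blocks in_setC r_toStop cardE; congr (_ ++ _ :: _).
  by apply: eq_map => x; rewrite !in_setC old_toStop.
by elim: (enum X) => //= x l ->; rewrite in_setC bar_toStop.
Qed.

End Coding.

(** * Program triples with a time budget *)

(** The states after a step are built with these functions and [set_mem], in which the
    previous state occurs once, so that terms stay linear in the number of steps. *)
Definition append_out s v : state := State (mem s) (inp s) (rcons (out s) v).
Definition set_inp s u : state := State (mem s) u (out s).

Section Machine.
Variable w : nat.
Implicit Types (p q : cmd) (s : state) (b : nat) (Q : state -> Prop).

(** Total correctness from one given state, with words bounded by w.  Fixing the state,
    instead of a precondition, lets straight-line code be executed symbolically. *)
Definition completes p s b Q : Prop := exists t s', [/\ t <= b, exec w p s t s' & Q s'].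

Lemma completes_leq p s b b' Q : b <= b' -> completes p s b Q -> completes p s b' Q.
Proof. by move=> bb' [t [s' [tb ex Qs']]]; exists t, s'; split=> //; apply: leq_trans bb'. Qed.

Lemma completes_Seq p q s b1 b2 R Q :
  completes p s b1 R -> (forall s', R s' -> completes q s' b2 Q) ->
  completes (Seq p q) s (b1 + b2) Q.
Proof.
move=> [t1 [s1 [tb1 ex1 Rs1]]] /(_ s1 Rs1) [t2 [s2 [tb2 ex2 Qs2]]].
exists (t1 + t2), s2; split=> //; first exact: leq_add.
exact: exec_Seq ex1 ex2.
Qed.

Lemma completes_step p q s s' b Q : exec w p s 1 s' ->
  completes q s' b Q -> completes (Seq p q) s b.+1 Q.
Proof.
move=> ex1 [t [s2 [tb ex2 Qs2]]]; exists t.+1, s2; split=> //.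
exact: (exec_Seq ex1 ex2).
Qed.

Lemma completes_Const i k q s b Q : k <= w ->
  completes q (set_mem s i k) b Q -> completes (Seq (Const i k) q) s b.+1 Q.
Proof. by move=> kw; apply: completes_step; apply: exec_Const. Qed.

(** The result v is a parameter tied by an equation, to be filled with a simplified
    value: keeping the lookups in s would double the term at each step. *)
Lemma completes_Add i j k q s v b Q : mem s j + mem s k = v -> v <= w ->
  completes q (set_mem s i v) b Q -> completes (Seq (Add i j k) q) s b.+1 Q.
Proof. by move=> <- vw; apply: completes_step; apply: exec_Add. Qed.

Lemma completes_Sub i j k q s v b Q : mem s j - mem s k = v ->
  completes q (set_mem s i v) b Q -> completes (Seq (Sub i j k) q) s b.+1 Q.
Proof. by move=> <-; apply: completes_step; apply: exec_Sub. Qed.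

Lemma completes_Write i q s v b Q : mem s i = v ->
  completes q (append_out s v) b Q ->
  completes (Seq (Write i) q) s b.+1 Q.
Proof. by move=> <-; apply: completes_step; apply: exec_Write. Qed.

Lemma completes_Read i q s v u b Q : inp s = v :: u -> v <= w ->
  completes q (set_mem (set_inp s u) i v) b Q ->
  completes (Seq (Read i) q) s b.+1 Q.
Proof. by move=> s_inp vw; apply: completes_step; apply: exec_Read s_inp vw. Qed.

Lemma completes_Skip s Q : Q s -> completes Skip s 1 Q.
Proof. by exists 1, s; split=> //; apply: exec_Skip. Qed.

(** The loop rule.  The invariant is indexed by the list l of items still to be
    processed, and the counter register i holds the size of l; this one form covers
    loops of fixed cost and the loop over hyperedges, whose cost depends on the item.
    The successors count the loop tests. *)
Lemma completes_While T i body (cost : T -> nat) (I : seq T -> state -> Prop) :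
    (forall l s, I l s -> mem s i = size l) ->
    (forall a l s, I (a :: l) s -> completes body s (cost a) (I l)) ->
  forall l s, I l s ->
    completes (While i body) s (\sum_(a <- l) (cost a).+1).+1 (I [::]).
Proof.
move=> size_l stepI; elim=> [|a l IHl] s Is.
  by exists 1, s; split=> //; apply: exec_WhileF; rewrite (size_l _ _ Is).
have [t1 [s1 [tb1 ex1 Is1]]] := stepI _ _ _ Is.
have [t2 [s2 [tb2 ex2 Is2]]] := IHl _ Is1.
exists (t1 + t2).+1, s2; split=> //; first by rewrite big_cons; lia.
by apply: exec_WhileT ex1 ex2; rewrite (size_l _ _ Is).
Qed.

End Machine.

Definition block : seq cmd -> cmd := foldr Seq Skip.

(** Executes the next elementary instruction, other than Read; the word bound of Const
    and Add and the rest of the program are left as goals. *)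
Ltac step :=
  let value := rewrite /=; reflexivity in
  lazymatch goal with |- completes _ ?p _ _ _ =>
    lazymatch eval hnf in p with
    | Skip => apply: completes_Skip
    | Seq ?c _ =>
      lazymatch eval hnf in c with
      | Skip => apply: completes_step; [exact: exec_Skip |]
      | Const _ _ => apply: completes_Const
      | Add _ _ _ => apply: completes_Add; [value | |]
      | Sub _ _ _ => apply: completes_Sub; [value |]
      | Write _ => apply: completes_Write; [value |]
      end
    end
  end.

(** * Programs on bit vectors *)

(** Register 0 counts the bits to read, register 1 holds 1, register 2 the current bit. *)
Definition bit_body (flip : bool) : cmd :=
  block [:: Read 2; if flip then Sub 2 1 2 else Skip; Write 2; Sub 0 0 1].

(** The output written so far, followed by the bits still due for l, is a fixed target.
    Register 3 is left untouched: [forward] keeps the length of its padding there. *)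
Definition bit_inv (rest target : seq nat) (flip : bool) (n : nat) (l : seq bool) s :=
  [/\ mem s 0 = size l, mem s 1 = 1, mem s 3 = n,
      inp s = [seq nat_of_bool d | d <- l] ++ rest
    & out s ++ [seq nat_of_bool (flip (+) d) | d <- l] = target].

Lemma bit_body_run w flip rest target n d l s : 0 < w ->
  bit_inv rest target flip n (d :: l) s ->
  completes w (bit_body flip) s 5 (bit_inv rest target flip n l).
Proof.
case: s => m i o w_gt0 [/= m0 m1 m3 ii oo].
apply: completes_Read; [exact: ii | by apply: leq_trans w_gt0; case: d {ii oo} |].
by case: flip oo => oo; do 4!step; split=> //=;
  rewrite ?m0 ?m1 ?subn1 // cat_rcons -oo; case: d {ii oo}.
Qed.

(** Covers [toStop] (no flip) and [toMod] (flip): the n + 1 padding bits, for r and the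
    bar x, all lie in the image of the former and outside that of the latter, so they
    are the negation of flip. *)
Definition forward (flip : bool) : cmd :=
  block [:: Read 0; Const 1 1; Add 3 0 1;
            While 0 (bit_body flip);
            Const 2 (~~ flip);
            While 3 (block [:: Write 2; Sub 3 3 1])].

Definition backward (flip : bool) : cmd :=
  block [:: Read 0; Const 1 1; While 0 (bit_body flip)].

(** The padding is left unread in rest. *)
Lemma backward_run flip (l : seq bool) rest b : 10 * (size l).+1 <= b ->
  runs_within (backward flip) b (size l :: [seq nat_of_bool d | d <- l] ++ rest)
    [seq nat_of_bool (flip (+) d) | d <- l].
Proof.
move=> le_b; apply: (@completes_leq _ _ _ (1 + (1 + ((size l * 6).+1 + 1))) b
  (fun s => out s = [seq nat_of_bool (flip (+) d) | d <- l])); first lia.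
apply: completes_Read; [by [] | lia | ]; step; first lia.
apply: (@completes_Seq _ _ _ _ _ _
    (bit_inv rest [seq nat_of_bool (flip (+) d) | d <- l] flip 0 [::])).
  rewrite -sum_const_nat_seq; apply: completes_While => [|d l' s|]; last by split.
    by move=> l' s [].
  by apply: bit_body_run; lia.
by move=> s [_ _ _ _ outs]; step; rewrite -outs cats0.
Qed.

Lemma forward_run flip (l : seq bool) b : 20 * (size l).+1 <= b ->
  runs_within (forward flip) b (size l :: [seq nat_of_bool d | d <- l])
    ([seq nat_of_bool (flip (+) d) | d <- l] ++ nseq (size l).+1 (nat_of_bool (~~ flip))).
Proof.
set target := _ ++ _ => le_b.
apply: (@completes_leq _ _ _ (1 + (1 + (1 + ((size l * 6).+1 +
   (1 + (((size l).+1 * 4).+1 + 1))))))  b (fun s => out s = target)); first lia.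
apply: completes_Read; [by [] | lia | ]; step; first lia.
step; first by rewrite /=; lia.
apply: (@completes_Seq _ _ _ _ _ _
    (bit_inv [::] [seq nat_of_bool (flip (+) d) | d <- l] flip (size l).+1 [::])).
  rewrite -sum_const_nat_seq; apply: completes_While => [|d l' s|].
  - by move=> l' s [].
  - by apply: bit_body_run; lia.
  by split; rewrite //= ?cats0 ?addn1.
move=> [m i o] [/= m0 m1 m3 _ oo]; step; first by case: flip {oo target}; lia.
pose I (l' : seq unit) s :=
  [/\ mem s 1 = 1, mem s 2 = ~~ flip, mem s 3 = size l'
    & out s ++ nseq (size l') (nat_of_bool (~~ flip)) = target].
apply: (@completes_Seq _ _ _ _ _ _ (I [::])).
  have -> : (size l).+1 = size (nseq (size l).+1 tt) by rewrite size_nseq.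
  rewrite -sum_const_nat_seq; apply: completes_While => [|u l' s|].
  - by move=> l' s [].
  - case: s => m' i' o' [/= n1 n2 n3 oo']; do 3!step.
    by split; rewrite //= ?n1 ?n3 ?subn1 // cat_rcons n2.
  by split; rewrite //= size_nseq // /target -oo cats0.
by move=> s [_ _ _ outs]; step; rewrite -outs cats0.
Qed.

(** * Constructing the hypergraph *)

(** Registers: 0 holds n, 2 holds 1, 6 and 7 hold the edge sizes 2 and 3, 8 counts the
    remaining vertices, 10 is the current vertex i and 11 is n + 1 + i. *)
Definition vertex_body : cmd :=
  block [:: Write 6; Write 0; Write 11; Write 7; Write 0; Write 10; Write 11;
            Add 10 10 2; Add 11 11 2; Sub 8 8 2].

Definition copy_body : cmd := block [:: Read 12; Write 12; Sub 5 5 2].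

(** Register 1 counts the remaining edges, 5 the elements left in the current edge, and
    12 is scratch. *)
Definition edge_body : cmd :=
  block [:: Read 5; Add 12 5 2; Write 12; Write 0; While 5 copy_body; Sub 1 1 2].

(** The prologue writes the number 2n + 1 of elements and the number 2n + m of edges,
    where m is the number of hyperedges read.  Registers 9 and 10 still hold their
    initial 0. *)
Definition construct : cmd :=
  block [:: Read 0; Read 1; Const 2 1; Add 3 0 2; Add 4 0 3; Write 4;
            Add 5 0 0; Add 5 5 1; Write 5; Const 6 2; Const 7 3;
            Add 8 0 9; Add 11 0 2;
            While 8 vertex_body; While 1 edge_body].

Section ConstructRun.
Variables (w n m : nat) (u target : seq nat).

(** The list l is the final segment of 0, ..., n - 1 that starts at register 10. *)
Definition vertex_inv (l : seq nat) s : Prop :=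
  [/\ [/\ mem s 0 = n, mem s 1 = m & mem s 2 = 1],
      [/\ mem s 6 = 2, mem s 7 = 3 & mem s 8 = size l],
      [/\ mem s 11 = n.+1 + mem s 10, mem s 10 + size l = n & l = iota (mem s 10) (size l)],
      inp s = u
    & out s ++ flatten [seq encode_vertex n i | i <- l] = target].

Lemma vertex_body_run a l s : 2 * n + 1 <= w ->
  vertex_inv (a :: l) s -> completes w vertex_body s 11 (vertex_inv l).
Proof.
case: s => me i o le_w [/= [m0 m1 m2] [m6 m7 m8] [m11 le_n [a_eq l_eq]] ii oo].
do 7!step; step; first by rewrite /=; lia.
step; first by rewrite /=; lia.
do 2!step.
split=> //=; first by rewrite m8 m2 subn1.
  by split; rewrite ?m11 ?m2; [lia | lia | rewrite addn1].
by rewrite m6 m0 m11 m7 !cat_rcons -oo a_eq.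
Qed.

Definition copy_inv (rest target' : seq nat) k (l : seq nat) s : Prop :=
  [/\ mem s 0 = n, mem s 1 = k, mem s 2 = 1 & mem s 5 = size l]
  /\ [/\ all (leq^~ w) l, inp s = l ++ rest & out s ++ l = target'].

Lemma copy_body_run rest target' k a l s :
  copy_inv rest target' k (a :: l) s ->
  completes w copy_body s 4 (copy_inv rest target' k l).
Proof.
case: s => me i o [/= [m0 m1 m2 m5] [/andP [a_le l_le] ii oo]].
apply: completes_Read; [exact: ii | exact: a_le |]; do 3!step.
by split; split; rewrite //= ?m5 ?m2 ?subn1 // cat_rcons.
Qed.

Definition encode_list (s : seq nat) := size s :: s.

Definition edge_inv (l : seq (seq nat)) s : Prop :=
  [/\ [/\ mem s 0 = n, mem s 1 = size l & mem s 2 = 1],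
      all (fun e => (size e < w) && all (leq^~ w) e) l,
      inp s = flatten [seq encode_list e | e <- l]
    & out s ++ flatten [seq encode_lifted n e | e <- l] = target].

Lemma edge_body_run e l s : edge_inv (e :: l) s ->
  completes w edge_body s (5 * size e + 7) (edge_inv l).
Proof.
case: s => me i o [/= [m0 m1 m2] /andP [/andP [e_lt e_le] l_le] ii oo].
apply: (@completes_leq _ _ _ (4 + ((size e * 5).+1 + 2))); first lia.
apply: completes_Read; [exact: ii | exact: ltnW |].
step; first by rewrite /= m2 addn1.
do 2!step.
apply: (@completes_Seq _ _ _ _ _ _ (copy_inv (flatten [seq encode_list e | e <- l])
    (o ++ encode_lifted n e) (size l).+1 [::])).
  rewrite -sum_const_nat_seq; apply: completes_While => [l' s [[]] //||].
    exact: copy_body_run.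
  by split; split; rewrite //= ?m0 ?m2 ?addn1 // !cat_rcons.
move=> [me' i' o'] [/= [n0 n1 n2 _] [_ ii' oo']]; do 2!step.
by split; rewrite //= ?n1 ?n2 ?subn1 //; rewrite cats0 in oo'; rewrite oo' -catA.
Qed.

End ConstructRun.

Lemma construct_run n (ss : seq (seq nat)) b :
  20 * (n + size ss + \sum_(e <- ss) size e).+1 <= b ->
  all (fun e => (size e < b) && all (leq^~ b) e) ss ->
  runs_within construct b
    (n :: size ss :: flatten [seq encode_list e | e <- ss])
    (n + n.+1 :: n + n + size ss ::
     flatten [seq encode_vertex n i | i <- iota 0 n]
     ++ flatten [seq encode_lifted n e | e <- ss]).
Proof.
set u := flatten _; set edges_out := flatten [seq encode_lifted n e | e <- ss].
set target := [:: n + n.+1, _ & _] => le_b ss_le.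
apply: (@completes_leq _ _ _
  (* 13 instructions of prologue, 12 steps per vertex, then the edges. *)
  (13 + ((n * 12).+1 + ((\sum_(e <- ss) (5 * size e + 7).+1).+1 + 1))) b
  (fun s => out s = target)).
  apply: leq_trans le_b; under eq_bigr do rewrite -addnS.
  by rewrite big_split /= -big_distrr sum_const_nat_seq /=; lia.
apply: completes_Read; [by [] | lia |]; apply: completes_Read; [by [] | lia |].
do 3![step; first by rewrite /=; lia]; step.
do 2![step; first by rewrite /=; lia]; step.
do 4![step; first by rewrite /=; lia].
pose vertices_out :=
  [:: n + n.+1, n + n + size ss & flatten [seq encode_vertex n i | i <- iota 0 n]].
apply: (@completes_Seq _ _ _ _ _ _ (vertex_inv n (size ss) u vertices_out [::])).
  have -> : n * 12 = \sum_(i <- iota 0 n) 12 by rewrite sum_const_nat_seq size_iota.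
  apply: completes_While => [l s [_ []] //|i l s|].
    by apply: vertex_body_run; lia.
  by split; rewrite //= ?size_iota ?addn0 ?addn1.
move=> [me i o] [/= [m0 m1 m2] _ _ ii oo].
apply: (@completes_Seq _ _ _ _ _ _ (edge_inv b n target [::])).
  apply: completes_While => [l s [[]] //||]; first exact: edge_body_run.
  by split; rewrite //= -[o]cats0 oo.
by move=> s [_ _ _ outs]; step; rewrite -outs cats0.
Qed.

(** * The programs on hypergraphs and sets *)

Section Transport.
Variable X : finType.
Implicit Types (A : hypergraph X) (T : {set X}).

Lemma construct_HA A u : encodes A u ->
  exists2 v, encodes (HA A) v & runs_within construct (bigO 40 (inc_length A)) u v.
Proof.
case=> es [uniq_es uniq_s defA ->]; have listA : listing A es by [].
have [uniq_HA uniq_sHA defHA] := listing_HA listA.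
pose ss := [seq [seq val (enum_rank x) | x <- e] | e <- es].
exists (#|U X| :: size (HA_list es) :: flatten [seq encode_edge e | e <- HA_list es]).
  by exists (HA_list es).
have size_ss : size es = size ss by rewrite size_map.
have -> : flatten [seq encode_edge e | e <- es] = flatten [seq encode_list e | e <- ss].
  by rewrite -map_comp; congr flatten; apply: eq_map => e /=; rewrite /encode_list size_map.
have lenA : inc_length A = #|X| + size ss + \sum_(e <- ss) size e.
  rewrite (inc_length_listing listA) size_ss big_map.
  by congr (_ + _); apply: eq_bigr => e _; rewrite size_map.
rewrite card_U size_HA_list encode_HA_list size_ss; apply: construct_run.
  by rewrite -lenA /bigO; lia.
(* Sizes of duplicate-free lists and element numbers are at most n, which fits a word. *)
have X_lt : #|X| < bigO 40 (inc_length A) by rewrite /bigO; lia.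
apply/allP => _ /mapP [e e_es ->]; rewrite size_map; apply/andP; split.
  by apply: leq_ltn_trans X_lt; rewrite -(card_uniqP (allP uniq_es e e_es)) max_card.
by apply/allP => _ /mapP [x _ ->]; apply: ltnW (ltn_trans (ltn_ord _) X_lt).
Qed.

Lemma bits_addb (flip : bool) T :
  [seq nat_of_bool (flip (+) d) | d <- [seq x \in T | x <- enum X]] =
  bits (if flip then ~: T else T).
Proof.
rewrite /bits -map_comp; apply: eq_map => x /=.
by case: flip; rewrite ?inE.
Qed.

Lemma forward_bits A T (flip : bool) :
  runs_within (forward flip) (bigO 40 (inc_length A)) (#|X| :: bits T)
    (bits (if flip then ~: T else T) ++ nseq #|X|.+1 (nat_of_bool (~~ flip))).
Proof.
have size_T : #|X| = size [seq x \in T | x <- enum X] by rewrite size_map cardE.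
rewrite -bits_addb size_T {1}/bits (map_comp nat_of_bool (fun x => x \in T)).
by apply: forward_run; rewrite -size_T /bigO /inc_length; lia.
Qed.

Lemma backward_bits A T (flip : bool) rest :
  runs_within (backward flip) (bigO 40 (inc_length A)) (#|X| :: bits T ++ rest)
    (bits (if flip then ~: T else T)).
Proof.
have size_T : #|X| = size [seq x \in T | x <- enum X] by rewrite size_map cardE.
rewrite -bits_addb size_T {1}/bits (map_comp nat_of_bool (fun x => x \in T)).
by apply: backward_run; rewrite -size_T /bigO /inc_length; lia.
Qed.

End Transport.

Theorem theoremD1 :
  (forall (X : finType) (A : hypergraph X),
    [/\ order_iso_onto (@toStop X) (transversals A) (Stop (HA A) :\ set0),
        MinStop (HA A) = [set toStop T | T in Tr A],
        (forall T : {set X}, toMod T = emb (~: T))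
      & bij_onto (@toMod X) (Tr A) (coatoms (Mod (Phi (HA A))))])
  /\ (exists c : nat, forall (X : finType) (A : hypergraph X),
        inc_length (HA A) <= bigO c (inc_length A))
  /\ (exists (p : cmd) (c : nat), forall (X : finType) (A : hypergraph X) (u : seq nat),
        encodes A u ->
        exists2 v, encodes (HA A) v & runs_within p (bigO c (inc_length A)) u v)
  /\ (exists (p : cmd) (c : nat), forall (X : finType) (A : hypergraph X) (T : {set X}),
        T \in transversals A ->
        runs_within p (bigO c (inc_length A)) (#|X| :: bits T) (bits (toStop T)))
  /\ (exists (p : cmd) (c : nat), forall (X : finType) (A : hypergraph X) (T : {set X}),
        T \in transversals A ->
        runs_within p (bigO c (inc_length A)) (#|X| :: bits (toStop T)) (bits T))
  /\ (exists (p : cmd) (c : nat), forall (X : finType) (A : hypergraph X) (T : {set X}),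
        T \in Tr A ->
        runs_within p (bigO c (inc_length A)) (#|X| :: bits T) (bits (toMod T)))
  /\ (exists (p : cmd) (c : nat), forall (X : finType) (A : hypergraph X) (T : {set X}),
        T \in Tr A ->
        runs_within p (bigO c (inc_length A)) (#|X| :: bits (toMod T)) (bits T)).
Proof.
split=> [X A|].
  split; [exact: toStop_iso | exact: MinStop_HA | exact: toModE | exact: toMod_bij].
split.
  by exists 10 => X A; apply: leq_trans (inc_length_HA A) _; rewrite /bigO; lia.
split; first by exists construct, 40 => X A u; apply: construct_HA.
split.
  by exists (forward false), 40 => X A T _; rewrite bits_toStop; apply: (forward_bits A T false).
split.
  by exists (backward false), 40 => X A T _; rewrite bits_toStop; apply: (backward_bits A T false).
split.
  by exists (forward true), 40 => X A T _; rewrite bits_toMod; apply: (forward_bits A T true).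
(* The input holds the bits of the complement of T, which the program flips again. *)
exists (backward true), 40 => X A T _.
by rewrite bits_toMod -[in X in runs_within _ _ _ X](setCK T); apply: (backward_bits A (~: T) true).
Qed.
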